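(* Let $N\ge 1$, let $\Omega_1,\dots,\Omega_N$ be finite nonempty sets with $m_i=\#\Omega_i$, let $\Omega=\Omega_1\times\cdots\times\Omega_N$, and let $0<\eta<1$. Let $(\lambda_n)_{n\in\mathbb N}$ be a strictly monotone decreasing sequence of positive numbers converging to zero. Let $\nu$ be a strictly positive probability measure on $\mathbb N^2$ (where $\mathbb N=\{1,2,\dots\}$), and let $A_{kn}=\{1,\dots,k\}\times\{1,\dots,n\}$. Let $P_0$ be a probability distribution on $\Omega$ (the true distribution), and let the training data $\mathbf x_1,\dots,\mathbf x_l$ ($l\ge1$) be drawn independently and identically distributed according to $P_0$. Then, with probability at least $1-\eta$, the inequality $$R(P)\le R_{emp}(P)+\phi\bigl(k,\lambda_n,\eta\,\nu(A_{kn})\bigr)$$ holds for all $k\in\{1,\dots,N\}$, all $n\in\mathbb N$ and all $P\in\mathcal H_k^{\lambda_n}$.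
   Context: Model class: for $1\le k\le N$ and $\lambda>0$, $\mathcal H_k^\lambda$ is the set of probability distributions $Q$ on $\Omega$ such that $Q(\mathbf x)>\lambda$ for all $\mathbf x\in\Omega$ and $Q$ is a $k$-factor distribution, i.e. $Q(x_1,\dots,x_N)=\prod_{\mathbf j} q_{\mathbf j}(x_{j_1},\dots,x_{j_k})$, where $\mathbf j=\{j_1<\dots<j_k\}$ runs over all $k$-element subsets of $\{1,\dots,N\}$ and each $q_{\mathbf j}:\Omega_{j_1}\times\cdots\times\Omega_{j_k}\to(0,\infty)$ is a positive function. Risk and empirical risk: for a strictly positive probability distribution $Q$ on $\Omega$, $$R(Q):=-\sum_{\mathbf x\in\Omega}P_0(\mathbf x)\ln Q(\mathbf x),\qquad R_{emp}(Q):=-\frac1l\sum_{i=1}^{l}\ln Q(\mathbf x_i).$$ Confidence term: with $h_k:=\sum_{\mathbf j} m_{j_1}\cdots m_{j_k}$ (sum over all $k$-element subsets $\mathbf j=\{j_1,\dots,j_k\}$ of $\{1,\dots,N\}$), for $0<\delta<1$, $$\phi(k,\lambda,\delta):=-\ln\lambda\;\sqrt{\frac{h_k-\ln h_k+\ln 16+\ln l-\ln\delta}{l}}\,.$$ *)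

(* Defs.v *)
From HB Require Import structures.
From mathcomp Require Import all_boot all_order all_algebra.
From mathcomp Require Import all_classical all_reals all_analysis.

Set Implicit Arguments.
Unset Strict Implicit.
Unset Printing Implicit Defensive.

Import Order.TTheory GRing.Theory Num.Theory.
Import numFieldNormedType.Exports.

Local Open Scope classical_set_scope.
Local Open Scope ring_scope.

Section FactorModels.
Variables (R : realType) (N : nat) (Omega : 'I_N -> finType).

Definition config : finType := {dffun forall i : 'I_N, Omega i}.

(* Omega_(j_1) x ... x Omega_(j_k), where j = {j_1 < ... < j_k}. *)
Definition subconfig (j : {set 'I_N}) : finType :=
  {dffun forall i : {i : 'I_N | i \in j}, Omega (val i)}.

Definition subconfig_of (j : {set 'I_N}) (x : config) : subconfig j :=
  [ffun i : {i : 'I_N | i \in j} => (x (val i) : Omega (val i))].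

Definition is_distribution (Q : config -> R) : Prop :=
  (forall x, 0 <= Q x) /\ \sum_(x : config) Q x = 1.

Definition is_factor_distribution (k : nat) (Q : config -> R) : Prop :=
  is_distribution Q /\
  exists q : forall j : {set 'I_N}, subconfig j -> R,
    (forall (j : {set 'I_N}) (y : subconfig j), #|j| = k -> 0 < q j y) /\
    (forall x : config,
       Q x = \prod_(j : {set 'I_N} | #|j| == k) q j (subconfig_of j x)).

Definition model_class (k : nat) (lambda : R) : set (config -> R) :=
  [set Q | is_factor_distribution k Q /\ forall x, lambda < Q x].

Definition risk (P0 Q : config -> R) : R :=
  - \sum_(x : config) P0 x * ln (Q x).

Definition empirical_risk (l : nat) (xs : 'I_l -> config) (Q : config -> R) : R :=
  - (l%:R^-1 * \sum_(i < l) ln (Q (xs i))).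

Definition hdim (k : nat) : nat :=
  (\sum_(j : {set 'I_N} | #|j| == k) \prod_(i in j) #|Omega i|)%N.

Definition confidence (l k : nat) (lambda delta : R) : R :=
  - ln lambda *
  Num.sqrt (((hdim k)%:R - ln (hdim k)%:R + ln 16%:R + ln l%:R - ln delta)
            / l%:R).

(* config is finite and carries the discrete sigma-algebra. *)
Definition iid_sample d (T : measurableType d) (Pr : probability T R)
    (l : nat) (P0 : config -> R) (X : 'I_l -> T -> config) : Prop :=
  [/\ forall i (A : set config), measurable (X i @^-1` A),
      forall i x, Pr (X i @^-1` [set x]) = (P0 x)%:E
    & forall (J : {set 'I_l}) (A : 'I_l -> set config),
        Pr (\bigcap_(i in [set` J]) (X i @^-1` A i)) =
        (\prod_(i in J) Pr (X i @^-1` A i))%E].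

End FactorModels.

Definition box (k n : nat) : set (nat * nat) :=
  [set p | (1 <= p.1 <= k)%N && (1 <= p.2 <= n)%N].

(* nat contains 0, so a strictly positive probability measure on
   {1, 2, ...}^2 is encoded as a probability on nat * nat carried by the
   pairs of positive integers. *)
Definition positive_weight (R : realType) (nu : probability (nat * nat)%type R)
    : Prop :=
  nu [set p | (1 <= p.1)%N && (1 <= p.2)%N] = 1%E /\
  forall k n : nat, (1 <= k)%N -> (1 <= n)%N -> (0 < nu [set (k, n)])%E.

(* Main.v *)
(** After division by [- ln lambda], the functions [- ln P] for [P] in the
    [k]-th class take values in [0, 1] and lie in a linear space spanned by
    [h_k] indicator functions, independently of [lambda]; so a single
    supremum, of the deviations between true and empirical means over this
    normalised class, handles all [n] at once and only [nu (A_kn) <= 1]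
    matters.  Expanding [g - 1/2] in an orthonormal system of [L2(P0)] bounds
    the mean of the supremum by [sqrt (h_k / l) / 2], and McDiarmid's
    inequality gives, at the radius of the theorem for [delta = eta], a
    failure probability of at most [(eta / 16) h_k exp (- h_k / 2)], hence at
    most [eta / (2 h_k)].  Since [h_k >= 'C(N, k) >= N] for [0 < k < N], these
    sum over [k] to at most [eta]. *)

Require Import Defs.
From HB Require Import structures.
From mathcomp Require Import all_boot all_order all_algebra.
From mathcomp Require Import all_classical all_reals all_analysis.
From mathcomp Require Import ring lra.

Set Implicit Arguments.
Unset Strict Implicit.
Unset Printing Implicit Defensive.

Import Order.TTheory GRing.Theory Num.Theory.
Import numFieldNormedType.Exports.

Local Open Scope classical_set_scope.
Local Open Scope ring_scope.

(** * Hoeffding's lemma on a finite probability space *)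

Lemma is_derive_ge0_le (R : realType) (f df : R -> R) (a t : R) :
  (forall x : R, is_derive x (1 : R) f (df x)) -> (forall x, a <= x -> 0 <= df x) ->
  a <= t -> f a <= f t.
Proof.
move=> fd df0 at0.
have fc : {within `[a, t], continuous f}.
  by apply: derivable_within_continuous => x _; exact: ex_derive.
have [c] := MVT_segment at0 (fun x _ => fd x) fc.
rewrite in_itv/= => /andP[ac _] E.
by rewrite -subr_ge0 E mulr_ge0 ?subr_ge0 ?df0.
Qed.

(** The function [D x = x p + x^2 / 8 - ln (W x)] and its derivative vanish at 0, and its second
    derivative is nonnegative because [(1 - p) p e^x <= W^2 / 4] by the arithmetic-geometric mean
    inequality. *)
Lemma bernoulli_mgf_le (R : realType) (p t : R) : 0 <= p <= 1 -> 0 <= t ->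
  1 - p + p * expR t <= expR (t * p + t ^+ 2 / 8).
Proof.
move=> /andP[p0 p1] t0.
pose W x : R := 1 - p + p * expR x.
have W0 x : 0 < W x.
  rewrite /W; have [->|pn0] := eqVneq p 0; first by lra.
  have := mulr_gt0 (_ : 0 < p) (expR_gt0 x); rewrite lt_neqAle eq_sym pn0 p0 => /(_ erefl).
  lra.
have dW x : is_derive x (1 : R) W (p * expR x).
  apply: is_derive_eq; rewrite /GRing.scale/=; ring.
have dV x : is_derive x (1 : R) (fun y => (W y)^-1) (- (W x) ^- 2 * (p * expR x)).
  apply: is_derive_eq (is_deriveV _ _) _; first by rewrite gt_eqF.
  by rewrite /GRing.scale/=.
pose D1 x : R := p + x / 4 - 1 + (1 - p) / W x.
pose D2 x : R := 1 / 4 - (1 - p) * (p * expR x) / (W x) ^+ 2.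
have dD1 x : is_derive x (1 : R) D1 (D2 x).
  apply: is_derive_eq; rewrite /D2 /GRing.scale/=; ring.
pose D x : R := x * p + x * x / 8 - ln (W x).
have dD x : is_derive x (1 : R) D (D1 x).
  have := is_derive1_ln (W0 x) => dl.
  have dlW : is_derive x (1 : R) (@ln R \o W) ((W x)^-1 * (p * expR x)).
    exact: is_derive1_comp.
  apply: is_derive_eq; rewrite /D1 /GRing.scale/=.
  have := lt0r_neq0 (W0 x); rewrite /W => Wn; field.
  exact: Wn.
have D20 x : 0 <= D2 x.
  rewrite /D2 subr_ge0 ler_pdivrMr ?exprn_gt0//.
  have := sqr_ge0 ((1 - p) - p * expR x); rewrite /W; nra.
have D10 x : 0 <= x -> 0 <= D1 x.
  move=> x0; apply: le_trans (is_derive_ge0_le dD1 (fun x _ => D20 x) x0).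
  by rewrite /D1 /W expR0; rewrite mulr1 subrK divr1; lra.
have := is_derive_ge0_le dD D10 t0.
rewrite {1}/D {1}/W expR0 mulr1 subrK ln1 mul0r mulr0 mul0r addr0 subrr /D subr_ge0 -expr2.
by rewrite -ler_expR lnK ?posrE.
Qed.

(** By convexity [expR] lies below its chord over [[s m, s (m + c)]], with [m] the minimum of [g].
    Averaging the chord gives the Bernoulli case with parameter [p], the mean of [(g - m) / c]. *)
Lemma hoeffding (R : realType) (A : finType) (P g : A -> R) (c s : R) :
  (forall a, 0 <= P a) -> \sum_a P a = 1 -> 0 < c -> 0 <= s ->
  (forall a b, g a - g b <= c) ->
  \sum_a P a * expR (s * g a) <= expR (s * (\sum_a P a * g a) + (s * c) ^+ 2 / 8).
Proof.
move=> P0 P1 c0 s0 gc.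
have [a0 _|A0] := pickP (@predT A); last first.
  have := P1; rewrite big_pred0 ?[X in X = _]/= => [/esym/eqP|a]; first by rewrite oner_eq0.
  by have := A0 a.
pose m := g [arg min_(a < a0) g a]%O.
have mg a : m <= g a.
  by rewrite /m; case: arg_minP => // b _; apply.
have gm a : g a - m <= c by exact: gc.
pose y a := (g a - m) / c.
have y01 a : 0 <= y a <= 1.
  by rewrite /y ler_pdivrMr// mul1r gm divr_ge0 ?subr_ge0// ltW.
have gE a : g a = m + c * y a by rewrite /y mulrC divfK ?gt_eqF// addrC subrK.
have convex a : expR (s * g a) <= expR (s * m) * (1 - y a + y a * expR (s * c)).
  rewrite gE mulrDr expRD ler_pM2l ?expR_gt0//.
  have /andP[ya0 ya1] := y01 a.
  have := convex_expR (Itv01 ya0 ya1) (s * c) 0.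
  rewrite !convRE/= mulr0 addr0 expR0.
  by rewrite (mulrA s) (mulrC (s * c)) mulr1 addrC.
pose p := \sum_a P a * y a.
have pE : \sum_a P a * g a = m + c * p.
  rewrite -[m]mul1r -P1 mulr_suml mulr_sumr -big_split/=.
  by apply: eq_bigr => a _; rewrite gE; ring.
have p01 : 0 <= p <= 1.
  rewrite sumr_ge0 => [|a _]; last by rewrite mulr_ge0//; case/andP: (y01 a).
  rewrite -P1 ler_sum// => a _; rewrite ler_piMr//; by case/andP: (y01 a).
apply: (@le_trans _ _ (expR (s * m) * (1 - p + p * expR (s * c)))).
  rewrite -[1 in X in _ <= X]P1 /p -sumrB mulr_suml -big_split mulr_sumr /=.
  apply: ler_sum => a _; apply: le_trans (ler_wpM2l (P0 a) (convex a)) _.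
  by rewrite le_eqVlt; apply/orP; left; apply/eqP; ring.
apply: le_trans (ler_wpM2l (expR_ge0 _) (bernoulli_mgf_le p01 (mulr_ge0 s0 (ltW c0)))) _.
by rewrite -expRD pE ler_expR le_eqVlt; apply/orP; left; apply/eqP; ring.
Qed.

(** * Expectations over independent samples *)

Section IidExpectation.
Variables (R : realType) (A : finType) (P : A -> R).
Hypotheses (P_ge0 : forall a, 0 <= P a) (P_sum1 : \sum_a P a = 1).

(** Expectation under the product measure [P^l], taken one coordinate at a time so that induction on
    [l] conditions on the first point. Lists let [F] keep its type along the recursion. *)
Fixpoint Ex (l : nat) (F : seq A -> R) : R :=
  if l is l'.+1 then \sum_a P a * Ex l' (fun s => F (a :: s)) else F [::].

(** The comparison is asked only on samples from the support of [P], since the orthonormal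
    expansions below hold only there. *)
Lemma Ex_le l F G :
  (forall s, size s = l -> all (fun a => P a != 0) s -> F s <= G s) ->
  Ex l F <= Ex l G.
Proof.
elim: l F G => [|l IH] F G FG /=; first exact: FG.
apply: ler_sum => a _; have [->|Pa] := eqVneq (P a) 0; first by rewrite !mul0r.
by apply/ler_wpM2l/IH => // s sl sP; apply: FG; rewrite /= ?sl ?Pa.
Qed.

Lemma eq_Ex l F G : (forall s, size s = l -> F s = G s) -> Ex l F = Ex l G.
Proof. by move=> FG; apply/eqP; rewrite eq_le !Ex_le// => s sl _; rewrite FG. Qed.

Lemma ExD l F G : Ex l (fun s => F s + G s) = Ex l F + Ex l G.
Proof.
elim: l F G => //= l IH F G.
by rewrite -big_split; apply: eq_bigr => a _; rewrite IH mulrDr.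
Qed.

Lemma ExZ l c F : Ex l (fun s => c * F s) = c * Ex l F.
Proof.
elim: l F => //= l IH F.
by rewrite mulr_sumr; apply: eq_bigr => a _; rewrite IH mulrCA.
Qed.

Lemma Ex_cst l c : Ex l (fun=> c) = c.
Proof. by elim: l => //= l ->; rewrite -mulr_suml P_sum1 mul1r. Qed.

Lemma Ex_bigsum (I : Type) (r : seq I) (Q : pred I) l (F : I -> seq A -> R) :
  Ex l (fun s => \sum_(i <- r | Q i) F i s) = \sum_(i <- r | Q i) Ex l (F i).
Proof.
elim: r => [|i r IH].
  by rewrite big_nil -[RHS](Ex_cst l); apply: eq_Ex => s _; rewrite big_nil.
rewrite big_cons -IH; case: (boolP (Q i)) => Qi.
  by rewrite -ExD; apply: eq_Ex => s _; rewrite big_cons Qi.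
by apply: eq_Ex => s _; rewrite big_cons (negbTE Qi).
Qed.

Lemma Ex_tuple l F :
  Ex l F = \sum_(t : l.-tuple A) (\prod_(i < l) P (tnth t i)) * F t.
Proof.
elim: l F => [|l IH] F /=.
  rewrite (bigD1 [tuple])//= big_ord0 mul1r big1 ?addr0// => t.
  by case/eqP; exact: tuple0.
rewrite (reindex (fun p : A * l.-tuple A => cons_tuple p.1 p.2))/=; last first.
  exists (fun t : l.+1.-tuple A => (thead t, behead_tuple t)) => [[a t] _|t _] /=.
    by congr pair; apply: val_inj.
  by rewrite [RHS]tuple_eta; apply: val_inj.
rewrite -(pair_big predT predT (fun a (t : l.-tuple A) =>
   (\prod_(i < l.+1) P (tnth (cons_tuple a t) i)) * F (cons_tuple a t)))/=.
apply: eq_bigr => a _; rewrite IH mulr_sumr; apply: eq_bigr => t _.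
rewrite mulrA big_ord_recl tnth0; congr (_ * _ * _).
by apply: eq_bigr => i _; rewrite tnthS.
Qed.

(** The martingale argument: averaging over all points but the first gives [g], which again
    oscillates by at most [c], so Hoeffding's lemma contributes a factor [exp ((s c)^2 / 8)] per
    point. *)
Lemma mcdiarmid_mgf (c s : R) l F : 0 < c -> 0 <= s ->
  (forall u a b w, F (u ++ a :: w) - F (u ++ b :: w) <= c) ->
  Ex l (fun x => expR (s * F x)) <= expR (s * Ex l F + l%:R * ((s * c) ^+ 2 / 8)).
Proof.
move=> c0 s0; elim: l F => [|l IH] F Fc /=; first by rewrite mul0r addr0.
pose g a := Ex l (fun x => F (a :: x)).
have gc a b : g a - g b <= c.
  rewrite lerBlDr -[c](Ex_cst l) -ExD; apply: Ex_le => x _ _.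
  by rewrite -lerBlDr; exact: (Fc [::]).
apply: (@le_trans _ _ (expR (l%:R * ((s * c) ^+ 2 / 8)) *
    \sum_a P a * expR (s * g a))).
  rewrite mulr_sumr; apply: ler_sum => a _; rewrite mulrCA -expRD addrC.
  by apply/ler_wpM2l/IH => // u; exact: (Fc (a :: u)).
apply: le_trans (ler_wpM2l (expR_ge0 _) (hoeffding P_ge0 P_sum1 c0 s0 gc)) _.
by rewrite -expRD ler_expR -[l.+1%:R]natr1 [X in _ <= _ + X]mulrDl mul1r addrCA.
Qed.

Lemma Ex_sum_centered l (u : A -> R) : \sum_a P a * u a = 0 ->
  Ex l (fun x => \sum_(a <- x) u a) = 0.
Proof.
move=> u0; elim: l => [|l IH] /=; first by rewrite big_nil.
rewrite -[RHS]u0; apply: eq_bigr => a _; congr (_ * _).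
under eq_Ex do rewrite big_cons.
by rewrite ExD Ex_cst IH addr0.
Qed.

(** Independence and centring kill the cross terms, so variances add. *)
Lemma Ex_sum_sqr l (u : A -> R) : \sum_a P a * u a = 0 ->
  Ex l (fun x => (\sum_(a <- x) u a) ^+ 2) = l%:R * \sum_a P a * u a ^+ 2.
Proof.
move=> u0; elim: l => [|l IH] /=; first by rewrite big_nil expr0n mul0r.
transitivity (\sum_a (P a * u a ^+ 2 + P a * (l%:R * \sum_a P a * u a ^+ 2))).
  apply: eq_bigr => a _; rewrite -mulrDr; congr (_ * _).
  under eq_Ex do rewrite big_cons sqrrD -mulrnAl.
  by rewrite !ExD (ExZ _ (u a *+ 2)) Ex_cst (Ex_sum_centered _ u0) mulr0 addr0 IH.
by rewrite big_split/= -mulr_suml P_sum1 mul1r -natr1 mulrDl mul1r addrC.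
Qed.

(** * Orthonormal systems in [L2(P)] *)

Definition ip (f g : A -> R) := \sum_a P a * (f a * g a).

Lemma ipC f g : ip f g = ip g f.
Proof. by apply: eq_bigr => a _; rewrite (mulrC (f a)). Qed.

Lemma ip_lin n (c : R) (f g : A -> R) (k : 'I_n -> R) (e : 'I_n -> A -> R) :
  ip f (fun a => c * (g a - \sum_i k i * e i a)) =
  c * (ip f g - \sum_i k i * ip f (e i)).
Proof.
under [in RHS]eq_bigr do rewrite mulr_sumr.
rewrite exchange_big/= -sumrB mulr_sumr; apply: eq_bigr => a _.
rewrite (mulrCA (f a)) (mulrCA (P a)) mulrBr mulrBr; congr (c * (_ - _)).
by rewrite !mulr_sumr; apply: eq_bigr => i _; rewrite (mulrCA (f a)) (mulrCA (P a)).
Qed.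

Lemma ip_eq0 (f : A -> R) : ip f f = 0 -> forall a, P a != 0 -> f a = 0.
Proof.
move=> /eqP; rewrite psumr_eq0 => [/allP f0 a Pa|a _]; last first.
  by rewrite mulr_ge0// -expr2 sqr_ge0.
have /implyP/(_ isT) := f0 a (mem_index_enum a).
by rewrite mulf_eq0 (negbTE Pa)/= mulf_eq0 orbb => /eqP.
Qed.

(* Since [P] may vanish, only the seminorm of [L2(P)] is available: each [e j]
   is either normalised or zero, and the expansions hold on the support. *)
Lemma gram_schmidt (v : nat -> A -> R) n : exists e : nat -> A -> R,
  [/\ forall i j, (i < n)%N -> (j < n)%N -> i != j -> ip (e i) (e j) = 0,
      forall j, (j < n)%N -> ip (e j) (e j) = 1 \/ e j = fun=> 0 &
      forall i a, (i < n)%N -> P a != 0 ->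
        v i a = \sum_(j < n) ip (v i) (e j) * e j a].
Proof.
elim: n => [|n [e [orth nrm expd]]]; first by exists (fun _ _ => 0).
(* The residual of [v n] after projection; the factor 1 matches the shape of [ip_lin]. *)
pose w a := 1 * (v n a - \sum_(j < n) ip (v n) (e j) * e j a).
(* Since the inverse of 0 is 0, a residual of zero norm makes the new vector identically zero. *)
pose c := (Num.sqrt (ip w w))^-1.
pose e' j := if j == n then fun a => c * w a else e j.
have e'n : e' n = fun a => c * w a by rewrite /e' eqxx.
have e'E j : (j < n)%N -> e' j = e j by rewrite /e'; case: eqVneq => // ->; rewrite ltnn.
have ipZ f k : ip f (fun a => k * w a) = k * ip f w.
  by rewrite /ip mulr_sumr; apply: eq_bigr => a _; ring.
have ip_ew m : (m < n)%N -> ip (e m) w = 0.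
  move=> mn; rewrite ip_lin mul1r (bigD1 (Ordinal mn))//= big1 ?addr0 => [|j jm].
    rewrite (ipC (v n)); case: (nrm m mn) => [->|->]; first by rewrite mulr1 subrr.
    by rewrite /ip !big1 ?mul0r ?subrr// => a _; rewrite ?mul0r mulr0.
  by rewrite orth ?mulr0// eq_sym; exact: jm.
have ip_vw : ip (v n) w = ip w w.
  rewrite [RHS](@ip_lin n 1 w (v n) (fun j : 'I_n => ip (v n) (e j)) (fun j : 'I_n => e j)).
  rewrite mul1r big1 ?subr0 1?ipC// => j _.
  by rewrite (ipC w) ip_ew ?mulr0.
have ww0 : 0 <= ip w w.
  by apply: sumr_ge0 => a _; rewrite mulr_ge0// -expr2 sqr_ge0.
have c2 : ip w w != 0 -> c * c * ip w w = 1.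
  move=> wn0; rewrite -expr2 exprVn sqr_sqrtr// mulVf//.
exists e'; split.
- move=> i j; rewrite !ltnS leq_eqVlt => /predU1P[->|ilt]; rewrite leq_eqVlt => /predU1P[->|jlt] ij.
  + by rewrite eqxx in ij.
  + by rewrite e'n e'E// ipC ipZ ip_ew// mulr0.
  + by rewrite e'n e'E// ipZ ip_ew// mulr0.
  + by rewrite !e'E// orth.
- move=> j; rewrite ltnS leq_eqVlt => /predU1P[->|jlt]; last by rewrite e'E//; exact: nrm.
  rewrite e'n; have [w0|wn0] := eqVneq (ip w w) 0.
    by right; rewrite /c w0 sqrtr0 invr0; apply/funext => a; rewrite mul0r.
  by left; rewrite ipZ ipC ipZ mulrA c2.
- move=> i a; rewrite ltnS leq_eqVlt => /predU1P[->|ilt] Pa; rewrite big_ord_recr/=.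
    rewrite e'n ipZ ip_vw (_ : _ * (c * w a) = c * c * ip w w * w a); last by ring.
    under eq_bigr do rewrite e'E//.
    have [w0|wn0] := eqVneq (ip w w) 0.
      have := ip_eq0 w0 Pa; rewrite w0 /w => /eqP.
      by rewrite mul1r subr_eq0 mulr0 mul0r addr0 => /eqP.
    by rewrite c2// mul1r /w mul1r addrC subrK.
  rewrite e'n ipZ.
  (* On the support, [v i] is already a combination of the earlier [e j], all orthogonal to [w]. *)
  have -> : ip (v i) w = 0.
    have -> : ip (v i) w = ip (fun b => \sum_(j < n) ip (v i) (e j) * e j b) w.
      apply: eq_bigr => b _; have [->|Pb] := eqVneq (P b) 0; first by rewrite !mul0r.
      by rewrite (expd i b).
    rewrite /ip; under eq_bigr do rewrite mulr_suml mulr_sumr.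
    rewrite exchange_big big1//= => j _.
    transitivity (ip (v i) (e j) * ip (e j) w); last by rewrite ip_ew ?mulr0.
    by rewrite [in RHS]/ip mulr_sumr; apply: eq_bigr => b _; ring.
  rewrite mulr0 mul0r addr0 (expd i a)//.
  by apply: eq_bigr => j _; rewrite e'E.
Qed.

End IidExpectation.

(** * Suprema of empirical deviations *)

Section Deviation.
Variables (R : realType) (A : finType) (P : A -> R) (G : set (A -> R)) (l : nat).
Hypotheses (P_ge0 : forall a, 0 <= P a) (P_sum1 : \sum_a P a = 1).
Hypotheses (l_gt0 : (0 < l)%N) (G_neq0 : G !=set0).
Hypothesis G01 : forall g, G g -> forall a, 0 <= g a <= 1.

Let dev (s : seq A) (g : A -> R) : R := \sum_a P a * g a - l%:R^-1 * \sum_(a <- s) g a.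

(** The divisor is the fixed [l], not the length of [s], so that bounded differences hold for lists
    of every length, as the martingale argument asks. *)
Definition sup_dev (s : seq A) : R :=
  sup [set \sum_a P a * g a - l%:R^-1 * \sum_(a <- s) g a | g in G].

Lemma dev_le_sup s g : G g ->
  \sum_a P a * g a - l%:R^-1 * \sum_(a <- s) g a <= sup_dev s.
Proof.
move=> Gg; apply: ub_le_sup; last by exists g.
exists 1 => _ [f Gf <-]; rewrite lerBlDr.
apply: (@le_trans _ _ 1).
  by rewrite -P_sum1 ler_sum// => a _; rewrite ler_piMr//; case/andP: (G01 Gf a).
rewrite lerDl mulr_ge0 ?invr_ge0 ?ler0n// sumr_ge0// => a _.
by case/andP: (G01 Gf a).
Qed.

Lemma sup_dev_le s c : (forall g, G g -> dev s g <= c) -> sup_dev s <= c.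
Proof.
move=> sc; apply: ge_sup; first by have [g Gg] := G_neq0; exists (dev s g), g.
by move=> _ [g Gg <-]; exact: sc.
Qed.

Lemma sup_dev_bounded_difference u a b w :
  sup_dev (u ++ a :: w) - sup_dev (u ++ b :: w) <= l%:R^-1.
Proof.
rewrite lerBlDr; apply: sup_dev_le => g Gg.
have := dev_le_sup (u ++ b :: w) Gg.
rewrite /dev !big_cat !big_cons/=.
have /andP[ga0 _] := G01 Gg a; have /andP[_ gb1] := G01 Gg b.
have l0 : 0 <= l%:R^-1 :> R by rewrite invr_ge0 ler0n.
have := mulr_ge0 l0 ga0; have := ler_wpM2l l0 gb1.
rewrite !mulrDr mulr1; lra.
Qed.

(** In the orthonormal system the deviation of [g - 1/2] reads [\sum_j k_j D_j], where the [k_j^2]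
    sum to at most 1/4 and each [D_j] has second moment at most [1 / l]. Completing squares with
    weight [tau = sqrt (h / l)] bounds it by [tau / 4 + (4 tau)^-1 \sum_j D_j^2], whose mean is at
    most [tau / 2]. *)
Lemma Ex_sup_dev_le h (v : nat -> A -> R) : (0 < h)%N ->
  (forall g, G g -> exists t : nat -> R,
     forall a, g a - 2^-1 = \sum_(i < h) t i * v i a) ->
  Ex P l sup_dev <= 2^-1 * Num.sqrt (h%:R / l%:R).
Proof.
move=> h0 Gv; have [e [_ nrm expd]] := gram_schmidt P_ge0 v h.
have lR : 0 < l%:R :> R by rewrite ltr0n.
have hR : 0 < h%:R :> R by rewrite ltr0n.
set tau := Num.sqrt _; have tau0 : 0 < tau by rewrite sqrtr_gt0 divr_gt0.
have tau2 : tau ^+ 2 = h%:R / l%:R by rewrite sqr_sqrtr// divr_ge0// ltW.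
have mean_cst s (c : R) : size s = l -> l%:R^-1 * \sum_(a <- s) c = c.
  move=> sl; rewrite big_const_seq count_predT sl iter_addr_0 mulrnAr -mulrnAl.
  by rewrite -[_ *+ l]mulr_natr mulVf ?mul1r// gt_eqF.
pose u j a := \sum_b P b * e j b - e j a.
have u0 j : \sum_a P a * u j a = 0.
  under eq_bigr do rewrite mulrBr.
  by rewrite sumrB -mulr_suml P_sum1 mul1r subrr.
have u2 j : (j < h)%N -> \sum_a P a * u j a ^+ 2 <= 1.
  move=> jh; apply: (@le_trans _ _ (ip P (e j) (e j))); last first.
    case: (nrm j jh) => [->//|->]; rewrite /ip big1// => a _.
    by rewrite mul0r mulr0.
  set m := \sum_b P b * e j b.
  have -> : \sum_a P a * u j a ^+ 2 = ip P (e j) (e j) - m ^+ 2.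
    transitivity (\sum_a (P a * (e j a * e j a) - 2 * m * (P a * e j a) + P a * m ^+ 2)).
      by apply: eq_bigr => a _; rewrite /u -/m; ring.
    rewrite big_split sumrB/= -mulr_sumr -mulr_suml P_sum1 -/m -/(ip P (e j) (e j)).
    ring.
  by rewrite gerBl sqr_ge0.
pose D j s := l%:R^-1 * \sum_(a <- s) u j a.
have ED j : (j < h)%N -> Ex P l (fun s => D j s ^+ 2) <= l%:R^-1.
  move=> jh; under (eq_Ex P_ge0) do rewrite exprMn.
  rewrite ExZ (Ex_sum_sqr P_ge0 P_sum1 l (u0 j)) mulrA expr2 -(mulrA l%:R^-1) mulVf ?gt_eqF// mulr1.
  by rewrite ler_piMr ?u2// invr_ge0 ltW.
have DE j s : size s = l ->
    D j s = \sum_a P a * e j a - l%:R^-1 * \sum_(a <- s) e j a.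
  move=> sl; rewrite /D /u sumrB mulrBr; congr (_ - _).
  exact: mean_cst.
(* This majorant is free of [g], so it also bounds the supremum. *)
apply: (@le_trans _ _ (Ex P l (fun s => tau / 4 + (4 * tau)^-1 * \sum_(j < h) D j s ^+ 2))).
  apply: Ex_le => // s sl sP; apply: sup_dev_le => g Gg.
  have [t gE] := Gv _ Gg.
  pose f a := g a - 2^-1.
  pose k (j : nat) := ip P f (e j).
  have fE a : P a != 0 -> f a = \sum_(j < h) k j * e j a.
    move=> Pa; rewrite /f gE.
    under eq_bigr => i _ do rewrite (expd i a (ltn_ord i) Pa) mulr_sumr.
    rewrite exchange_big/=; apply: eq_bigr => j _.
    under eq_bigr do rewrite mulrA.
    rewrite -mulr_suml; congr (_ * _); rewrite /k /ip.
    under eq_bigr do rewrite mulr_sumr.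
    rewrite exchange_big/=; apply: eq_bigr => b _.
    rewrite /f gE mulr_suml mulr_sumr; apply: eq_bigr => i _; ring.
  (* Parseval on the support of [P], with [f^2 <= 1/4] because [g] lies in [0, 1]. *)
  have kE : \sum_(j < h) k j ^+ 2 <= 4^-1.
    have -> : \sum_(j < h) k j ^+ 2 = ip P f f.
      transitivity (\sum_a P a * (f a * \sum_(j < h) k j * e j a)).
        under [RHS]eq_bigr do rewrite mulr_sumr mulr_sumr.
        rewrite exchange_big/=; apply: eq_bigr => j _.
        by rewrite expr2 {2}/k /ip mulr_sumr; apply: eq_bigr => a _; ring.
      apply: eq_bigr => a _; have [->|Pa] := eqVneq (P a) 0; first by rewrite !mul0r.
      by rewrite -fE.
    have -> : 4^-1 = \sum_a P a * 4^-1 by rewrite -mulr_suml P_sum1 mul1r.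
    apply: ler_sum => a _.
    apply: ler_wpM2l => //; have /andP[g0 g1] := G01 Gg a.
    have : 0 <= g a * (1 - g a) by rewrite mulr_ge0 ?subr_ge0.
    rewrite /f; lra.
  have devE : dev s g = \sum_(j < h) k j * D j s.
    (* Constants have zero deviation, as [s] has length [l]. *)
    transitivity (dev s f).
      rewrite /dev /f sumrB mulrBr mean_cst//.
      under [in RHS]eq_bigr do rewrite mulrBr.
      by rewrite sumrB -mulr_suml P_sum1; ring.
    under [RHS]eq_bigr do rewrite DE// mulrBr.
    rewrite sumrB; congr (_ - _).
      under [RHS]eq_bigr do rewrite mulr_sumr.
      rewrite exchange_big/=; apply: eq_bigr => a _.
      have [->|Pa] := eqVneq (P a) 0.
        by rewrite mul0r big1// => j _; rewrite mul0r mulr0.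
      by rewrite fE// mulr_sumr; apply: eq_bigr => j _; ring.
    under [RHS]eq_bigr do rewrite mulrCA.
    rewrite -mulr_sumr; congr (_ * _).
    under [RHS]eq_bigr do rewrite mulr_sumr.
    rewrite exchange_big/= big_seq [RHS]big_seq; apply: eq_bigr => a sa.
    by apply: fE; exact: (allP sP).
  rewrite devE; apply: (@le_trans _ _ (\sum_(j < h) (tau * k j ^+ 2 + (4 * tau)^-1 * D j s ^+ 2))).
    apply: ler_sum => j _; rewrite -subr_ge0.
    rewrite (_ : _ - _ = tau * (k j - (2 * tau)^-1 * D j s) ^+ 2); last first.
      by field; rewrite gt_eqF.
    by rewrite mulr_ge0 ?sqr_ge0// ltW.
  by rewrite big_split/= -!mulr_sumr lerD2r ler_pM2l.
rewrite ExD Ex_cst// ExZ Ex_bigsum//.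
apply: (@le_trans _ _ (tau / 4 + (4 * tau)^-1 * (h%:R / l%:R))).
  rewrite lerD2l ler_pM2l ?invr_gt0 ?mulr_gt0//.
  apply: (@le_trans _ _ (\sum_(j < h) l%:R^-1)); first by apply: ler_sum => j _; exact: ED.
  by rewrite sumr_const card_ord mulr_natl.
rewrite -tau2 le_eqVlt; apply/orP; left; apply/eqP; field.
by rewrite gt_eqF.
Qed.

(* Chernoff's bound at parameter [2 l eps], with
   [eps * sqrt (h l) <= (l eps^2 + h) / 2] for the mean. *)
Lemma sup_dev_tail h (v : nat -> A -> R) (eps : R) : (0 < h)%N -> 0 <= eps ->
  (forall g, G g -> exists t : nat -> R,
     forall a, g a - 2^-1 = \sum_(i < h) t i * v i a) ->
  Ex P l (fun s => ((eps < sup_dev s)%R%:R : R)) <= expR (h%:R / 2 - l%:R * eps ^+ 2).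
Proof.
move=> h0 eps0 Gv.
have lR : 0 < l%:R :> R by rewrite ltr0n.
have hR : 0 < h%:R :> R by rewrite ltr0n.
pose c : R := 2 * l%:R * eps; have c0 : 0 <= c by rewrite !mulr_ge0// ltW.
apply: (@le_trans _ _ (Ex P l (fun s => expR (- (c * eps)) * expR (c * sup_dev s)))).
  apply: Ex_le => // s _ _; rewrite -expRD.
  have [es|_] := boolP (eps < sup_dev s); last exact: expR_ge0.
  by rewrite -[1%:R]expR0 ler_expR addrC subr_ge0 ler_wpM2l// ltW.
rewrite ExZ.
have lV : 0 < l%:R^-1 :> R by rewrite invr_gt0.
apply: le_trans (ler_wpM2l (expR_ge0 _)
  (mcdiarmid_mgf P_ge0 P_sum1 l lV c0 sup_dev_bounded_difference)) _.
rewrite -expRD ler_expR.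
have := ler_wpM2l c0 (Ex_sup_dev_le h0 Gv).
set tau := Num.sqrt _; have tau0 : 0 < tau by rewrite sqrtr_gt0 divr_gt0.
have hE : h%:R = l%:R * tau ^+ 2 :> R.
  by rewrite sqr_sqrtr ?divr_ge0 ?(ltW lR) ?(ltW hR)// mulrC divfK ?gt_eqF.
have -> : l%:R * ((c / l%:R) ^+ 2 / 8) = l%:R * eps ^+ 2 / 2.
  by rewrite /c; field; rewrite gt_eqF.
rewrite hE /c; have := mulr_ge0 (ltW lR) (sqr_ge0 (eps - tau)); nra.
Qed.

End Deviation.

(** * Factor models *)

(** Passes from the abstract probability space to a finite sum: the event is the disjoint union,
    over the samples [t] satisfying [S], of the events that the data equal [t], whose probabilities
    are products. *)
Lemma iid_sample_prob (R : realType) (N : nat) (Omega : 'I_N -> finType)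
    (d : measure_display) (T : measurableType d) (Pr : probability T R) (l : nat)
    (P0 : config Omega -> R) (X : 'I_l -> T -> config Omega)
    (S : pred (seq (config Omega))) :
  iid_sample Pr P0 X ->
  Pr [set w | S [seq X i w | i <- enum 'I_l]] = (Ex P0 l (fun s => (S s)%:R))%:E.
Proof.
move=> [Xm XP Xind].
pose B (t : l.-tuple (config Omega)) := \bigcap_(i in [set` [set: 'I_l]%SET]) (X i @^-1` [set tnth t i]).
have BE t w : B t w <-> [tuple X i w | i < l] = t.
  split => [Bt|<-]; last by move=> i _; rewrite /= tnth_mktuple.
  by apply: eq_from_tnth => i; rewrite tnth_mktuple; apply: Bt; rewrite /= inE.
have SE w : [seq X i w | i <- enum 'I_l] = [tuple X i w | i < l].
  by [].
have -> : [set w | S [seq X i w | i <- enum 'I_l]] =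
    \bigcup_(t in [set` [pred t : l.-tuple (config Omega) | S t]]) B t.
  apply/seteqP; split => w /=.
    by rewrite SE => Sw; exists [tuple X i w | i < l] => //; apply/BE.
  by move=> [t /= St /BE Et]; rewrite SE Et.
rewrite measure_fin_bigcup//; first last.
- move=> t _; apply: fin_bigcap_measurable; first exact: finite_finset.
  by move=> i _; exact: Xm.
- by move=> t u _ _ [w [/BE + /BE]] => <- <-.
rewrite -(@bigfs _ _ _ _ (index_enum _))/= ?index_enum_uniq//; last first.
  by move=> t _; rewrite mem_index_enum.
rewrite Ex_tuple -sumEFin big_mkcond; apply: eq_bigr => t _.
case: (S t); rewrite ?mulr0// mulr1 Xind.
by rewrite -prodEFin; apply: eq_big => [i|i _]; rewrite ?inE// XP.
Qed.

Section FactorClass.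
Variables (R : realType) (N : nat) (Omega : 'I_N -> finType).

Lemma card_subconfig (j : {set 'I_N}) :
  #|subconfig Omega j| = (\prod_(i in j) #|Omega i|)%N.
Proof. by rewrite card_dep_ffun foldrE big_map big_enum/= [RHS]big_sub. Qed.

Lemma leq_bin_hdim k : (forall i, (0 < #|Omega i|)%N) -> ('C(N, k) <= hdim Omega k)%N.
Proof.
move=> O0; rewrite -[N in 'C(N, _)]card_ord -card_draws -sum1_card /hdim.
rewrite (eq_bigl (fun j : {set 'I_N} => #|j| == k)); last by move=> j; rewrite inE.
by apply: leq_sum => j _; exact: prodn_gt0.
Qed.

(** Logarithms turn the factorisation into a sum; [lambda] does not occur, so the normalised models
    of order [k] share this class for all [n]. *)
Definition factor_class (k : nat) : set (config Omega -> R) :=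
  [set g | (forall x, 0 <= g x <= 1) /\
    exists r : forall j, subconfig Omega j -> R,
      forall x, g x = \sum_(j : {set 'I_N} | #|j| == k) r j (subconfig_of j x)].

Lemma factor_class_neq0 k : factor_class k !=set0.
Proof.
exists (fun=> 0); split => [x|]; first by rewrite lexx ler01.
by exists (fun _ _ => 0) => x; rewrite big1.
Qed.

(** The spanning functions are the indicators that [x] restricts to [y] on [j], one for each pair
    [(j, y)] with [#|j| = k]. *)
Lemma factor_class_span k : config Omega -> (k <= N)%N ->
  exists v : nat -> config Omega -> R, forall g, factor_class k g ->
    exists t : nat -> R, forall x,
      g x - 2^-1 = \sum_(i < hdim Omega k) t i * v i x.
Proof.
move=> x0 kN.
pose I := {j : {set 'I_N} & subconfig Omega j}.
(* Only a default value for [nth]. *)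
pose p0 : I := Tagged (subconfig Omega) (subconfig_of finset.set0 x0).
pose Q := [pred p : I | #|tag p| == k].
have szQ : size (enum Q) = hdim Omega k.
  rewrite -cardE -sum1_card /hdim.
  under [RHS]eq_bigr do rewrite -card_subconfig -sum1_card.
  rewrite (sig_big_dep (fun j : {set 'I_N} => #|j| == k) (fun _ _ => true) (fun _ _ => 1%N)).
  by apply: eq_bigl => p; rewrite andbT.
exists (fun i x => (subconfig_of (tag (nth p0 (enum Q) i)) x == tagged (nth p0 (enum Q) i))%:R).
move=> g [_ [r gE]].
pose C : R := #|[set j : {set 'I_N} | #|j| == k]%SET|%:R.
have C0 : C != 0 by rewrite pnatr_eq0 -lt0n card_draws card_ord bin_gt0.
(* The constant 1/2 is spread evenly over the ['C(N, k)] subsets, so it costs no extra dimension. *)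
pose r' j y := r j y - 2^-1 / C.
exists (fun i => r' (tag (nth p0 (enum Q) i)) (tagged (nth p0 (enum Q) i))) => x.
transitivity (\sum_(j : {set 'I_N} | #|j| == k) r' j (subconfig_of j x)).
  rewrite sumrB -gE; congr (_ - _).
  rewrite (eq_bigl (fun j => j \in [set j : {set 'I_N} | #|j| == k]%SET)); last by move=> j; rewrite inE.
  by rewrite sumr_const -[RHS]mulr_natr divfK.
transitivity (\sum_(p <- enum Q) r' (tag p) (tagged p) * (subconfig_of (tag p) x == tagged p)%:R); last first.
  by rewrite (big_nth p0) big_mkord szQ.
rewrite big_enum/=.
transitivity (\sum_(j : {set 'I_N} | #|j| == k) \sum_(y : subconfig Omega j)
   r' j y * (subconfig_of j x == y)%:R).
  apply: eq_bigr => j _; rewrite (bigD1 (subconfig_of j x))//= eqxx mulr1.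
  by rewrite big1 ?addr0// => y /negbTE; rewrite eq_sym => ->; rewrite mulr0.
rewrite (sig_big_dep (fun j : {set 'I_N} => #|j| == k) (fun _ _ => true)
  (fun j y => r' j y * (subconfig_of j x == y)%:R)).
by apply: eq_bigl => p; rewrite andbT.
Qed.

(** From [lam < Q x <= 1] follow both [lam < 1], which makes the divisor positive, and the bounds 0
    and 1 on the quotient. *)
Lemma model_class_normalized k (lam : R) (Q : config Omega -> R) :
  config Omega -> model_class k lam Q -> 0 < lam ->
  0 < - ln lam /\ factor_class k (fun x => - ln (Q x) / - ln lam).
Proof.
move=> x0 [[[Q0 Q1] [q [q0 Qq]]] lamQ] lam0.
have Qle1 x : Q x <= 1 by rewrite -Q1 (bigD1 x)//= lerDl sumr_ge0.
have Qgt0 x : 0 < Q x by exact: lt_trans (lamQ x).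
have L0 : 0 < - ln lam.
  by rewrite oppr_gt0 ln_lt0// lam0 (lt_le_trans (lamQ x0)).
split=> //; split=> [x|].
  apply/andP; split.
    by rewrite divr_ge0 ?(ltW L0)// oppr_ge0 ln_le0.
  by rewrite ler_pdivrMr// mul1r lerN2 ler_ln ?posrE// ltW.
exists (fun j y => - ln (q j y) / - ln lam) => x.
rewrite -mulr_suml sumrN; congr (- _ / _).
rewrite Qq -[RHS]expRK expR_sum; congr ln; apply: eq_bigr => j /eqP jk.
by rewrite lnK// posrE q0.
Qed.

End FactorClass.

(** * Summing the failure probabilities over the order *)

Lemma leq_bin_mid N k : (0 < k < N)%N -> (N <= 'C(N, k))%N.
Proof.
elim: N k => [|N IH] [|k] // /andP[_]; rewrite ltnS => kN.
rewrite binS; have [kltN|eqkN] : (k.+1 < N)%N \/ k.+1 = N.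
- by move: kN; rewrite leq_eqVlt => /predU1P[->|]; [right|left].
- by rewrite -addn1 leq_add ?IH// bin_gt0 ltnW.
- by rewrite -eqkN binn binSn.
Qed.

(** Since [exp (h / 2) >= h^2 / 8], each term is at most [8 / H k]. The [N - 1] terms with [k < N]
    have [H k >= N] and add up to at most 8; the term [k = N] is at most 8 by itself. *)
Lemma sum_hdim_expR_le (R : realType) (H : nat -> nat) (N : nat) : (0 < N)%N ->
  (forall k, (0 < k < N)%N -> (N <= H k)%N) -> (0 < H N)%N ->
  \sum_(i < N) (H i.+1)%:R * expR (- ((H i.+1)%:R / 2)) <= 16 :> R.
Proof.
have hexp (h : nat) : (0 < h)%N -> h%:R * expR (- (h%:R / 2)) <= 8 / h%:R :> R.
  move=> h0; have hR : 0 < h%:R :> R by rewrite ltr0n.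
  rewrite expRN ler_pdivrMr ?expR_gt0// mulrAC ler_pdivlMr//.
  have h20 : 0 <= h%:R / 2 :> R by rewrite divr_ge0.
  have := expR_ge1Dxn 1 h20; rewrite (_ : 2`!%:R = 2)//; lra.
case: N => // n _ Hlt Hn; rewrite big_ord_recr/=.
have -> : 16 = 8 + 8 :> R by ring.
apply: lerD.
  apply: (@le_trans _ _ (\sum_(i < n) 8 / n.+1%:R)).
    apply: ler_sum => i _; have Hi := Hlt i.+1 (ltn_ord i).
    apply: le_trans (hexp _ (leq_trans _ Hi)) _ => //.
    by rewrite ler_pM2l// lef_pV2 ?posrE ?ltr0n ?ler_nat// (leq_trans _ Hi).
  rewrite sumr_const card_ord -[X in X <= _]mulr_natr mulrAC ler_pdivrMr ?ltr0n//.
  by rewrite ler_pM2l// ler_nat.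
apply: le_trans (hexp _ Hn) _.
by rewrite ler_pdivrMr ?ltr0n// ler_peMr// ler1n.
Qed.

(** * Mass of the boxes [A_kn] *)

Lemma measurable_box (k n : nat) : measurable (box k n).
Proof.
have -> : box k n = [set m : nat | (1 <= m <= k)%N] `*` [set m : nat | (1 <= m <= n)%N].
  by apply/seteqP; split => -[a b] /=; rewrite /box/= => /andP.
exact: measurableX.
Qed.

(** Each such box contains the pair (1, 1), whose mass is positive. *)
Lemma positive_weight_box (R : realType) (nu : probability (nat * nat)%type R) k n :
  positive_weight nu -> (0 < k)%N -> (0 < n)%N -> 0 < fine (nu (box k n)) <= 1.
Proof.
move=> [_ nu0] k0 n0; have mb := measurable_box k n.
have nu1 : (nu (box k n) <= 1)%E by exact: probability_le1.
have nup : (0 < nu (box k n))%E.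
  apply: lt_le_trans (nu0 1%N 1%N isT isT) _.
  apply: le_measure; rewrite ?inE; [|exact: mb|].
    rewrite (_ : [set (1%N, 1%N)] = [set 1%N] `*` [set 1%N]); first exact: measurableX.
    by apply/seteqP; split => -[a b] /= => [[-> ->]|[-> ->]].
  by move=> _ ->; rewrite /box/= k0 n0.
have nuf : nu (box k n) \is a fin_num.
  by rewrite ge0_fin_numE ?(ltW nup)// (le_lt_trans nu1) ?ltry.
by rewrite -lte_fin -lee_fin fineK// nup.
Qed.

(** * The deviation threshold of each order *)

Section Radius.
Variables (R : realType) (N : nat) (Omega : 'I_N -> finType) (l : nat) (eta : R).
Hypotheses (eta01 : 0 < eta < 1) (l_gt0 : (0 < l)%N).

(** It depends on neither [lambda] nor [nu], so one event per order [k] serves all [n]. *)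
Definition radius (k : nat) : R :=
  Num.sqrt (((hdim Omega k)%:R - ln (hdim Omega k)%:R + ln 16%:R - ln eta) / l%:R).

Lemma sqr_radius k : (0 < hdim Omega k)%N ->
  l%:R * radius k ^+ 2 =
  (hdim Omega k)%:R - ln (hdim Omega k)%:R + ln 16%:R - ln eta.
Proof.
move=> h0; have [eta0 eta1] := andP eta01.
rewrite sqr_sqrtr; first by rewrite mulrC divfK// pnatr_eq0 -lt0n.
have hR : 0 < (hdim Omega k)%:R :> R by rewrite ltr0n.
rewrite divr_ge0 ?ler0n//.
(* The radicand is nonnegative because [ln h < h] and [ln eta <= 0]; [Num.sqrt] would send a
   negative one to 0. *)
have := ln_sublinear hR; have : ln eta <= 0 by rewrite ln_le0// ltW.
have : 0 <= ln 16%:R :> R by rewrite ln_ge0// ler1n.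
lra.
Qed.

Lemma radius_le_confidence k (lam b : R) : 0 < - ln lam -> 0 < b <= 1 ->
  - ln lam * radius k <= confidence Omega l k lam (eta * b).
Proof.
move=> L0 /andP[b0 b1]; have [eta0 eta1] := andP eta01.
rewrite /confidence ler_pM2l// ler_wsqrtr// ler_pM2r ?invr_gt0 ?ltr0n//.
rewrite lnM ?posrE//.
have : ln b <= 0 by rewrite ln_le0.
have : 0 <= ln l%:R :> R by rewrite ln_ge0// ler1n.
lra.
Qed.

(** Exponentiation turns the logarithms in the radius into the factor [eta h / 16]; the 16 cancels
    the bound on the sum over orders. *)
Lemma expR_radius k : (0 < hdim Omega k)%N ->
  expR ((hdim Omega k)%:R / 2 - l%:R * radius k ^+ 2) =
  eta / 16 * ((hdim Omega k)%:R * expR (- ((hdim Omega k)%:R / 2))).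
Proof.
move=> h0; have [eta0 eta1] := andP eta01; rewrite sqr_radius//.
set h : R := (hdim Omega k)%:R; have hR : 0 < h by rewrite ltr0n.
have -> : h / 2 - (h - ln h + ln 16%:R - ln eta) = ln eta - ln 16%:R + (ln h + - (h / 2)).
  by field.
by rewrite expRD expRB (expRD (ln h)) !lnK ?posrE.
Qed.

End Radius.

(** * Union bound over the orders, uniformly in [n] *)

Theorem corollary1 (R : realType) (N : nat) (Omega : 'I_N -> finType)
    (eta : R) (lambda : nat -> R) (nu : probability (nat * nat)%type R)
    (P0 : config Omega -> R) (l : nat)
    (d : measure_display) (T : measurableType d) (Pr : probability T R)
    (X : 'I_l -> T -> config Omega)
    (N_ge1 : (1 <= N)%N)
    (Omega_nonempty : forall i, (0 < #|Omega i|)%N)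
    (eta_bounds : 0 < eta < 1)
    (lambda_pos : forall n, (1 <= n)%N -> 0 < lambda n)
    (lambda_decr : forall m n, (1 <= m)%N -> (m < n)%N -> lambda n < lambda m)
    (lambda_cvg0 : lambda @ \oo --> (0 : R))
    (nu_pos : positive_weight nu)
    (P0_distr : is_distribution P0)
    (l_ge1 : (1 <= l)%N)
    (X_iid : iid_sample Pr P0 X) :
  ((1 - eta)%:E <=
   Pr [set w | forall (k n : nat) (P : config Omega -> R),
         (1 <= k <= N)%N -> (1 <= n)%N -> model_class k (lambda n) P ->
         (risk P0 P <= empirical_risk (fun i => X i w) P
            + confidence Omega l k (lambda n) (eta * fine (nu (box k n))))%R])%E.
Proof.
have [eta0 eta1] := andP eta_bounds.
have [P0_ge0 P0_sum1] := P0_distr.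
have x0 : config Omega := [ffun i : 'I_N => (xchoose (elimT card_gt0P (Omega_nonempty i)) : Omega i)].
(* The index [i] stands for the order [k = i + 1]. *)
pose bad (i : 'I_N) s := radius Omega l eta i.+1 < sup_dev P0 (factor_class i.+1) l s.
pose good := fun s : seq (config Omega) => `[< forall (k n : nat) (P : config Omega -> R),
         (1 <= k <= N)%N -> (1 <= n)%N -> model_class k (lambda n) P ->
         (risk P0 P <= - (l%:R^-1 * \sum_(a <- s) ln (P a))
            + confidence Omega l k (lambda n) (eta * fine (nu (box k n))))%R >].
have h_gt0 k : (k <= N)%N -> (0 < hdim Omega k)%N.
  by move=> kN; apply: leq_trans (leq_bin_hdim k Omega_nonempty); rewrite bin_gt0.
set E := [set w | _].
have -> : E = [set w | good [seq X i w | i <- enum 'I_l]].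
  apply/seteqP; split => w.
    move=> Ew; apply/asboolP => k n P kN n1 PH.
    by have := Ew k n P kN n1 PH; rewrite /empirical_risk big_map big_enum.
  move=> /asboolP Ew k n P kN n1 PH.
  by have := Ew k n P kN n1 PH; rewrite /empirical_risk big_map big_enum.
rewrite (iid_sample_prob good X_iid) lee_fin.
(* The deterministic part: outside the bad events the normalised bound holds, and multiplying it by
   [- ln (lambda n)] gives the inequality for every [n]. *)
have good_of_not_bad s : (forall i, ~~ bad i s) -> good s.
  move=> nbad; apply/asboolP => k n P /andP[k1 kN] n1 PH.
  have [L0 gP] := model_class_normalized x0 PH (lambda_pos n n1).
  have kE : k.-1.+1 = k by rewrite prednK.
  have k'N : (k.-1 < N)%N by rewrite kE.
  have := nbad (Ordinal k'N); rewrite /bad/= kE -leNgt => sup_le.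
  have F01 (g : config Omega -> R) : factor_class k g -> forall a, 0 <= g a <= 1 by case.
  have := le_trans (dev_le_sup l P0_ge0 P0_sum1 F01 s gP) sup_le.
  rewrite -(ler_pM2l L0) => dev_le.
  have := le_trans dev_le (radius_le_confidence Omega eta_bounds l_ge1 k L0
    (positive_weight_box nu_pos k1 n1)).
  rewrite -lerBlDl /risk opprK; apply: le_trans.
  have cancelL x : - ln (lambda n) * (- ln (P x) / - ln (lambda n)) = - ln (P x).
    by rewrite mulrC divfK ?gt_eqF.
  rewrite mulrBr [in X in _ <= _ - X]mulrCA !mulr_sumr.
  under [in X in _ <= X - _]eq_bigr do rewrite mulrCA cancelL mulrN.
  under [in X in _ <= _ - X]eq_bigr do rewrite cancelL mulrN.
  by rewrite !sumrN !opprK.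
(* Pointwise union bound: the indicator of [good] is at least 1 minus the sum of the indicators of
   the bad events. *)
apply: (@le_trans _ _ (Ex P0 l (fun s => 1 + -1 * \sum_(i < N) ((bad i s)%:R : R)))); last first.
  apply: Ex_le => // s _ _; have [/existsP[i bi]|] := boolP [exists i, bad i s].
    apply: le_trans (ler0n _ _); rewrite mulN1r subr_le0 (bigD1 i)//= bi lerDl.
    exact: sumr_ge0.
  rewrite negb_exists => /forallP nbad; rewrite good_of_not_bad//.
  by rewrite mulN1r gerBl sumr_ge0.
rewrite ExD Ex_cst// ExZ mulN1r lerD2l lerN2 Ex_bigsum//.
apply: (@le_trans _ _ (\sum_(i < N) eta / 16 *
    ((hdim Omega i.+1)%:R * expR (- ((hdim Omega i.+1)%:R / 2))))).
  apply: ler_sum => i _; have hi := h_gt0 _ (ltn_ord i).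
  have [v vspan] := @factor_class_span R N Omega i.+1 x0 (ltn_ord i).
  rewrite -(expR_radius eta_bounds l_ge1)//.
  by apply: sup_dev_tail vspan => //; [exact: factor_class_neq0|move=> g []|exact: sqrtr_ge0].
rewrite -mulr_sumr; apply: (@le_trans _ _ (eta / 16 * 16)); last by rewrite divfK.
rewrite ler_pM2l ?divr_gt0//; apply: sum_hdim_expR_le => //; last exact: h_gt0.
move=> k /andP[k0 kN]; apply: leq_trans (leq_bin_hdim k Omega_nonempty).
by apply: leq_bin_mid; rewrite k0.
Qed.
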